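(* Let $\nu^0$ be a real common eigenvector of the matrices $A_j$ corresponding to the eigenvalues $\lambda^j$, $j=1,\ldots,m$, respectively. Let $\nu^\theta$, $\theta=1,\ldots,s-1$, be real generalized eigenvectors (of order $\theta$) of the matrix $A_\zeta$ corresponding to the eigenvalue $\lambda^\zeta$ with elementary divisor of multiplicity $s\ge2$. Then the completely solvable system $dx=A(x)\,dt$ has the first integrals $$F_q\colon(t,x)\to v_q^\zeta(x)-\sum_{j=1}^m\mu_q^{j\zeta}\,t_j\quad\text{for all }(t,x)\in\mathbb R^m\times\mathscr X,\quad q=1,\ldots,s-1,$$ where the set of functions $v_q^\zeta\colon\mathscr X\to\mathbb R$, $q=1,\ldots,s-1$, is the solution to the system $$\nu^\theta x=\sum_{\delta=1}^\theta\binom{\theta-1}{\delta-1}v_\delta^\zeta(x)\cdot\nu^{\theta-\delta}x,\quad\theta=1,\ldots,s-1,$$ the numbers $\mu_q^{j\zeta}=\mathfrak p_jv_q^\zeta(x)$, $q=1,\ldots,s-1$, $j=1,\ldots,m$, and $\mathscr X$ is a domain with $\mathscr X\subset\{x\colon\nu^0x\ne0\}$.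
   Context: Let $x=(x_1,\ldots,x_n)\in\mathbb R^n$, $t=(t_1,\ldots,t_m)\in\mathbb R^m$. Consider the linear autonomous system of equations in total differentials $dx=A(x)\,dt$, where $A(x)=\|a_{ij}(x)\|$ is $n\times m$ with $a_{ij}(x)=\sum_{\xi=1}^na_{ij\xi}x_\xi$, $a_{ij\xi}\in\mathbb R$. Put $\mathfrak p_j(x)=\sum_{i=1}^na_{ij}(x)\partial_{x_i}$, $j=1,\ldots,m$. The system is assumed completely solvable: $[\mathfrak p_j(x),\mathfrak p_k(x)]=0$ on $\mathbb R^n$ for all $j,k=1,\ldots,m$. Let $A_j$ be the real $n\times n$ matrix whose entry in row $i$ and column $\xi$ is $a_{\xi ji}$ (so the system is $dx=\sum_{j=1}^mA_j^{T}x\,dt_j$); complete solvability is equivalent to $A_jA_k=A_kA_j$ for all $j,k$. For a vector $\nu$, $\nu x=\sum_{i=1}^n\nu_ix_i$. The index $\zeta\in\{1,\ldots,m\}$ is chosen so that $A_\zeta$ has the smallest number of elementary divisors among $A_1,\ldots,A_m$. If $\nu^0$ is an eigenvector of $A_\zeta$ corresponding to the eigenvalue $\lambda^\zeta$ with elementary divisor of multiplicity $s$, a nonzero vector $\nu^\theta$ is called a generalized eigenvector of order $\theta$ for $\lambda^\zeta$ if and only if $(A_\zeta-\lambda^\zeta E)\nu^\theta=\theta\,\nu^{\theta-1}$, $\theta=1,\ldots,s-1$, where $E$ is the $n\times n$ identity matrix. A continuously differentiable function $F(t,x)$ on a domain is a first integral of the system if $\partial_{t_j}F+\mathfrak p_jF=0$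 there for $j=1,\ldots,m$.
   Formalization: For j other than ζ, when λ^ζ has more than one independent eigenvector of A_ζ, that p_j v_q is constant on X (so that the number μ_q^{jζ} exists) is assumed for the given q, since it can fail; in all other cases it is proved. *)

(* Defs.v *)
From HB Require Import structures.
From mathcomp Require Import all_boot all_order all_algebra.
From mathcomp Require Import complex.
From mathcomp Require Import all_classical all_reals all_analysis.
Import Order.TTheory GRing.Theory Num.Theory numFieldNormedType.Exports.

Set Implicit Arguments.
Unset Strict Implicit.
Unset Printing Implicit Defensive.

Local Open Scope classical_set_scope.
Local Open Scope ring_scope.

Section ElementaryDivisors.
Variable C : closedFieldType.

(* k-th determinantal divisor: the gcd of all k x k minors of X - A.
   Non-injective f or g only contribute the minor 0, which is neutral for the
   gcd; for k = 0 the only minor is the empty determinant 1. *)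
Definition determinantal_divisor n (A : 'M[C]_n) (k : nat) : {poly C} :=
  \big[@gcdp C/0]_(fg : {ffun 'I_k -> 'I_n} * {ffun 'I_k -> 'I_n})
     \det (mxsub fg.1 fg.2 (char_poly_mx A)).

(* Defined up to a nonzero scalar, since gcdp is not normalized; only meant for
   1 <= k <= n. *)
Definition invariant_poly n (A : 'M[C]_n) (k : nat) : {poly C} :=
  determinantal_divisor A k %/ determinantal_divisor A k.-1.

Definition distinct_roots (p : {poly C}) : seq C :=
  undup (sval (closed_field_poly_normal p)).

(* The elementary divisors ('X - z)^s of A, each listed as many times as it
   occurs: the prime-power factors of the invariant polynomials. *)
Definition elementary_divisors n (A : 'M[C]_n) : seq {poly C} :=
  flatten [seq [seq ('X - z%:P) ^+ mup z (invariant_poly A k)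
               | z <- distinct_roots (invariant_poly A k)]
          | k <- iota 1 n].

End ElementaryDivisors.

Section TotalDifferentialSystem.
Variable R : realType.

(* Elementary divisors of a real matrix are taken over the complex numbers. *)
Definition real_elementary_divisors n (A : 'M[R]_n) : seq {poly R[i]} :=
  elementary_divisors (map_mx (real_complex R) A).

Definition linform n (nu x : 'cV[R]_n) : R := \sum_i nu i 0 * x i 0.

(* Action of the vector field V, as a first-order differential operator. *)
Definition vf_deriv n (V : 'cV[R]_n -> 'cV[R]_n) (f : 'cV[R]_n -> R)
    (x : 'cV[R]_n) : R :=
  \sum_i V x i 0 * 'D_(delta_mx i 0) f x.

Definition lie_bracket n (V W : 'cV[R]_n -> 'cV[R]_n) (x : 'cV[R]_n) :
    'cV[R]_n :=
  \col_i (vf_deriv V (fun y => W y i 0) x - vf_deriv W (fun y => V y i 0) x).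

Definition domain (T : topologicalType) (D : set T) : Prop :=
  [/\ open D, connected D & D !=set0].

(* On the finite-dimensional spaces used here, continuity of the differential
   amounts to continuity of its value at each fixed vector. *)
Definition C1_on (U : normedModType R) (D : set U) (F : U -> R) : Prop :=
  forall p, D p -> differentiable F p /\
    forall w : U, {for p, continuous (fun p' => 'd F p' w)}.

Section System.
Variables m n : nat.

(* Coefficients: a i j xi is a_{ij xi}, so a_{ij}(x) = sum_xi a_{ij xi} x_xi. *)
Variable a : 'I_n -> 'I_m -> 'I_n -> R.

Definition sys_matrix (x : 'cV[R]_n) : 'M[R]_(n, m) :=
  \matrix_(i, j) \sum_xi a i j xi * x xi 0.

Definition sys_field (j : 'I_m) (x : 'cV[R]_n) : 'cV[R]_n :=
  col j (sys_matrix x).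

Definition completely_solvable : Prop :=
  forall j k x, lie_bracket (sys_field j) (sys_field k) x = 0.

(* Note the transposition of the indices i and xi. *)
Definition coef_mx (j : 'I_m) : 'M[R]_n := \matrix_(i, xi) a xi j i.

Definition first_integral (D : set ('cV[R]_m * 'cV[R]_n))
    (F : 'cV[R]_m * 'cV[R]_n -> R) : Prop :=
  C1_on D F /\
  forall (j : 'I_m) t x, D (t, x) ->
    'D_(delta_mx j 0) (fun t' => F (t', x)) t +
    vf_deriv (sys_field j) (fun x' => F (t, x')) x = 0.

End System.

Definition is_eigenvector n (A : 'M[R]_n) (lam : R) (nu : 'cV[R]_n) : Prop :=
  nu != 0 /\ A *m nu = lam *: nu.

(* nu theta is a generalized eigenvector of order theta over the chain nu;
   meant for theta >= 1. *)
Definition is_gen_eigenvector n (A : 'M[R]_n) (lam : R) (nu : nat -> 'cV[R]_n)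
    (theta : nat) : Prop :=
  nu theta != 0 /\ (A - lam%:M) *m nu theta = theta%:R *: nu theta.-1.

(* eigenspace is made of row vectors, whence the transposition: right
   eigenvectors of A are left eigenvectors of A^T. *)
Definition geometric_multiplicity n (A : 'M[R]_n) (lam : R) : nat :=
  \rank (eigenspace A^T lam).

End TotalDifferentialSystem.

(* Main.v *)
Require Import Defs.
From HB Require Import structures.
From mathcomp Require Import all_boot all_order all_algebra.
From mathcomp Require Import complex.
From mathcomp Require Import all_classical all_reals all_analysis.
From mathcomp Require Import ring.
Import Order.TTheory GRing.Theory Num.Theory numFieldNormedType.Exports.
Local Open Scope classical_set_scope.
Local Open Scope ring_scope.

(** The operator p_j acts on linear forms through the matrix A_j: it sends
nu x to (A_j nu) x.  Suppose that A_j acts on the Jordan chain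
nu^0, nu^1, ... in the binomial way
  A_j nu^th = sum_k C(th, k) c_k nu^(th - k),
with numbers c_0, c_1, ... depending on j but not on th.  In terms of the
exponential generating functions N(z) = sum_th (nu^th x) z^th / th!,
V(z) = sum_d v_(d+1)(x) z^d / d! and c(z) = sum_k c_k z^k / k!, this says
p_j N = c N, while the definition of the v_d reads N' = V N.  Hence V = N'/N
and p_j V = (p_j N / N)' = c', that is, p_j v_d = c_d is constant: this is
[binomial_convolution_derivation], carried out on coefficients, and
[vf_deriv_chain_coordinate].

The binomial form holds for A_zeta by definition of the chain, with
c = (lambda^zeta, 1, 0, 0, ...).  If lambda^zeta has a one-dimensional
eigenspace it holds for every A_j, because A_j commutes with A_zeta:
the two sides for th agree after applying A_zeta - lambda^zeta, so they differ
by a multiple of nu^0, and this multiple is the next c_th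
([commuting_chain]).  When the eigenspace is larger, the constancy of
p_j v_q for j <> zeta is the hypothesis of the theorem.

Once p_j v_q is a constant mu_j, subtracting sum_j mu_j t_j cancels it
([autonomous_first_integral]).  Smoothness comes from solving the triangular
system for v_q: the v_q are rational functions of x whose denominators are
powers of nu^0 x, which does not vanish on the domain. *)

(** * Binomial convolutions *)

Lemma mul_bin_comm (n d k : nat) :
  ('C(n, d) * 'C(n - d, k) = 'C(n, k) * 'C(n - k, d))%N.
Proof.
have [dkn|dkn] := leqP (d + k) n; last first.
  have z i j : (n < i + j)%N -> ('C(n, i) * 'C(n - i, j) = 0)%N.
    move=> nij; have [nlti|ilen] := ltnP n i; first by rewrite bin_small.
    by rewrite (@bin_small (n - i)%N) ?muln0 // ltn_subLR.
  by rewrite !z // addnC.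
have dn : (d <= n)%N by apply: leq_trans dkn; rewrite leq_addr.
have kn : (k <= n)%N by apply: leq_trans dkn; rewrite leq_addl.
have ff : (0 < d`! * k`! * (n - d - k)`!)%N by rewrite !muln_gt0 !fact_gt0.
apply/eqP; rewrite -(eqn_pmul2r ff); apply/eqP.
transitivity n`!.
  rewrite -(bin_fact dn) -(@bin_fact (n - d) k) ?leq_subRL //; ring.
rewrite -(bin_fact kn) -(@bin_fact (n - k) d) ?leq_subRL // 1?addnC //.
by rewrite subnAC; ring.
Qed.

(** A common range of summation makes the triangular double sums below
rectangular, so that they can be exchanged. *)
Lemma sum_binomial_widen (R : pzRingType) (n N : nat) (F : nat -> R) :
  (n <= N)%N ->
  \sum_(k < n.+1) 'C(n, k)%:R * F k = \sum_(k < N.+1) 'C(n, k)%:R * F k.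
Proof.
move=> nN; rewrite (big_ord_widen N.+1 (fun k => 'C(n, k)%:R * F k)) //.
rewrite big_mkcond /=; apply: eq_bigr => k _.
by case: ltnP => // nk; rewrite bin_small ?mul0r.
Qed.

(** In generating functions: N' = V N, D N = c N and D N' = (D V) N + V (D N)
force D V = c'.  Indeed D N' = (c N)' = c' N + c N', where the second term is
V (D N) and cancels, and N is invertible since its constant term is nonzero.
[DN] and [W] stand for the coefficients of D N and D V at one point. *)
Lemma binomial_convolution_derivation (F : fieldType) (s : nat)
    (N DN V W : nat -> F) (c : nat -> F) :
  N 0%N != 0 ->
  (forall th, (th <= s)%N ->
     DN th = \sum_(k < th.+1) 'C(th, k)%:R * (c k * N (th - k)%N)) ->
  (forall th, (th < s)%N ->
     N th.+1 = \sum_(d < th.+1) 'C(th, d)%:R * (V d * N (th - d)%N)) ->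
  (forall th, (th < s)%N ->
     DN th.+1 = \sum_(d < th.+1)
       'C(th, d)%:R * (W d * N (th - d)%N + V d * DN (th - d)%N)) ->
  forall th, (th < s)%N -> W th = c th.+1.
Proof.
move=> N0 hDN hN hW th; elim/ltn_ind: th => th IH ths.
(* V (c N) = c N', coefficientwise. *)
have VDN : \sum_(d < th.+1) 'C(th, d)%:R * (V d * DN (th - d)%N) =
           \sum_(k < th.+1) 'C(th, k)%:R * (c k * N (th.+1 - k)%N).
  transitivity (\sum_(d < th.+1) \sum_(k < th.+1)
      ('C(th, d) * 'C(th - d, k))%:R * (c k * (V d * N (th - d - k)%N))).
    apply: eq_bigr => d _; rewrite hDN; last first.
      exact: leq_trans (leq_subr _ _) (ltnW ths).
    rewrite (@sum_binomial_widen _ _ th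
              (fun k => c k * N (th - d - k)%N)) ?leq_subr //.
    rewrite !mulr_sumr; apply: eq_bigr => k _; rewrite natrM; ring.
  rewrite exchange_big /=; apply: eq_bigr => k _.
  have kth : (k <= th)%N by rewrite -ltnS.
  rewrite subSn // hN; last exact: leq_ltn_trans (leq_subr _ _) ths.
  rewrite (@sum_binomial_widen _ _ th
            (fun d => V d * N (th - k - d)%N)) ?leq_subr //.
  rewrite !mulr_sumr; apply: eq_bigr => d _.
  rewrite mul_bin_comm subnAC natrM; ring.
(* The Leibniz rule (c N)' = c N' + c' N is Pascal's rule. *)
have pascal : DN th.+1 =
    \sum_(k < th.+1) 'C(th, k)%:R * (c k * N (th.+1 - k)%N) +
    \sum_(k < th.+1) 'C(th, k)%:R * (c k.+1 * N (th - k)%N).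
  rewrite hDN // big_ord_recl /= bin0 mul1r subn0.
  rewrite (@sum_binomial_widen _ _ th.+1 (fun k => c k * N (th.+1 - k)%N)) //.
  rewrite [X in _ = X + _]big_ord_recl /= bin0 mul1r subn0 -addrA; congr (_ + _).
  rewrite -big_split /=; apply: eq_bigr => k _.
  by rewrite /bump /= add1n subSS binS natrD mulrDl.
(* (D V) N = c' N; in the coefficient of index th the unknown W th occurs
   once, multiplied by N 0. *)
have WN : \sum_(d < th.+1) 'C(th, d)%:R * (W d * N (th - d)%N) =
          \sum_(d < th.+1) 'C(th, d)%:R * (c d.+1 * N (th - d)%N).
  apply: (addrI (\sum_(d < th.+1) 'C(th, d)%:R * (V d * DN (th - d)%N))).
  rewrite {2}VDN -pascal hW // addrC -big_split /=.
  by apply: eq_bigr => d _; rewrite mulrDr.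
move: WN; rewrite !big_ord_recr /= binn !mul1r subnn.
rewrite (eq_bigr (fun d : 'I_th => 'C(th, d)%:R * (c d.+1 * N (th - d)%N))).
  by move/addrI/(mulIf N0).
by move=> d _; rewrite IH // (ltn_trans (ltn_ord d)).
Qed.

(** * Jordan chains and commuting matrices *)

Section CommutingChain.
Variables (R : realType) (n : nat).
Local Notation V := 'cV[R]_n.

(** After transposition u and u0 lie in a row space of rank at most 1, which
the nonzero u0 already spans. *)
Lemma eigenspace_line (A : 'M[R]_n) (lam : R) (u0 u : V) :
  (geometric_multiplicity A lam <= 1)%N -> is_eigenvector A lam u0 ->
  A *m u = lam *: u -> exists c : R, u = c *: u0.
Proof.
move=> gm [u00 Au0] Au.
have inE (w : V) : A *m w = lam *: w -> (w^T <= eigenspace A^T lam)%MS.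
  by move=> Aw; apply/eigenspaceP; rewrite -trmx_mul Aw linearZ.
have r0 : \rank u0^T = 1%N.
  by rewrite rank_rV trmx_eq0 u00.
have : (eigenspace A^T lam <= u0^T)%MS.
  rewrite -(mxrank_leqif_sup (inE _ Au0)) eqn_leq r0 gm andbT.
  by rewrite -r0 mxrankS // inE.
by move=> /(submx_trans (inE _ Au))/sub_rVP[c uE]; exists c;
  apply: trmx_inj; rewrite uE linearZ.
Qed.

(** Along a Jordan chain B acts as a polynomial in A - lam; the normalization
(A - lam) nu^th = th nu^(th-1) is what produces the binomial factors.  The
coefficients are found one at a time: since B commutes with A - lam, applying
A - lam reduces the formula for th to the one for th - 1, which determines
B nu^th up to an eigenvector of A, that is, up to a multiple c_th nu^0. *)
Lemma commuting_chain (A B : 'M[R]_n) (lam lamB : R) (s : nat)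
    (nu : nat -> V) :
  A *m B = B *m A -> (geometric_multiplicity A lam <= 1)%N ->
  is_eigenvector A lam (nu 0%N) -> is_eigenvector B lamB (nu 0%N) ->
  (forall th, (1 <= th < s)%N -> is_gen_eigenvector A lam nu th) ->
  exists c : nat -> R, forall th, (th < s)%N ->
    B *m nu th = \sum_(k < th.+1) 'C(th, k)%:R *: (c k *: nu (th - k)%N).
Proof.
move=> AB gm e0 [_ Be0] Hnu.
have nuS th : (th.+1 < s)%N -> (A - lam%:M) *m nu th.+1 = th.+1%:R *: nu th.
  by move=> ths; have [] := Hnu th.+1 ths.
have nu0 : (A - lam%:M) *m nu 0%N = 0.
  by rewrite mulmxBl mul_scalar_mx e0.2 subrr.
have comm : (A - lam%:M) *m B = B *m (A - lam%:M).
  by rewrite mulmxBl mulmxBr AB scalar_mxC.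
elim: s Hnu nuS => [|s IH] Hnu nuS; first by exists (fun=> 0).
have [|th ths|c Hc] := IH.
- by move=> th /andP[th1 ths]; apply: Hnu; rewrite th1 ltnW.
- exact/nuS/ltnW.
case: s => [|s] in Hnu nuS c Hc IH *.
  exists (fun=> lamB) => -[|//] _.
  by rewrite big_ord_recl big_ord0 addr0 bin0 scale1r subn0.
(* The sum omits k = s.+1: that coefficient is not yet determined, and its
   term is killed by A - lam. *)
pose S := \sum_(k < s.+1) 'C(s.+1, k)%:R *: (c k *: nu (s.+1 - k)%N).
have kerE : (A - lam%:M) *m (B *m nu s.+1 - S) = 0.
  rewrite mulmxBr mulmxA comm -mulmxA nuS // -scalemxAr Hc //.
  rewrite /S mulmx_sumr scaler_sumr -sumrB big1 // => k _.
  rewrite subSn -1?ltnS // -!scalemxAr nuS; last first.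
    by rewrite !ltnS leq_subr.
  rewrite !scalerA -scalerBl; apply/eqP; rewrite scaler_eq0; apply/orP; left.
  have ks : (k <= s)%N by rewrite -ltnS.
  have := mul_bin_down s.+1 k; rewrite /= subSn // => /(congr1 (fun i => i%:R : R)).
  by rewrite !natrM mulrA => ->; apply/eqP; ring.
have [|c' c'E] := eigenspace_line _ _ _ (B *m nu s.+1 - S) gm e0.
  by apply/eqP; rewrite -subr_eq0 -mul_scalar_mx -mulmxBl kerE.
exists (fun k => if k == s.+1 then c' else c k) => th; rewrite ltnS leq_eqVlt.
case/predU1P => [->|ths].
  rewrite big_ord_recr /= eqxx binn scale1r subnn -c'E addrC.
  rewrite (eq_bigr (fun k : 'I_s.+1 =>
    'C(s.+1, k)%:R *: (c k *: nu (s.+1 - k)%N))) ?subrK // => k _.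
  by rewrite ltn_eqF.
rewrite Hc //; apply: eq_bigr => k _; rewrite ltn_eqF //.
exact: leq_trans (ltn_ord k) ths.
Qed.
End CommutingChain.

(** * Continuously differentiable functions *)

Section C1.
Variable R : realType.

(** The differential is a local notion: the Taylor expansion of f at p is
also one of g. *)
Lemma near_eq_diff (U : normedModType R) (f g : U -> R) (p : U) :
  {near p, f =1 g} -> differentiable f p ->
  differentiable g p /\ 'd g p = 'd f p :> (U -> R).
Proof.
move=> fg df.
have gp : f p = g p by exact: nbhs_singleton fg.
have dE : g \o shift p = cst (g p) + 'd f p +o_ 0 id.
  apply/eqaddoP => e e0.
  have /eqaddoP/(_ _ e0) := diff_locally df.
  have fg0 : \forall h \near (0 : U), f (h + p) = g (h + p).
    have fg' : \near p, f p = g p by exact: fg.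
    by rewrite (near_shift 0 p) subr0 in fg'.
  by apply: filterS2 fg0 => h fgh; rewrite /= !fctE /= fgh gp.
have dg : 'd g p = 'd f p :> (U -> R).
  by apply: diff_unique dE; apply: diff_continuous.
split => //; apply/diff_locallyP; rewrite dg; split => //.
exact: diff_continuous.
Unshelve. all: by end_near. Qed.

Variable U : normedModType R.
Implicit Types (D : set U) (f g : U -> R).

(** On an open set a formula [df] for the differential valid pointwise is
valid near each point, so its continuity can be checked instead. *)
Lemma C1_on_intro D f (df : U -> U -> R) : open D ->
  (forall p, D p -> differentiable f p) ->
  (forall p, D p -> 'd f p = df p :> (U -> R)) ->
  (forall p w, D p -> {for p, continuous (fun p' => df p' w)}) -> C1_on D f.
Proof.
move=> oD dif dE dc p Dp; split => [|w]; first exact: dif.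
have nD : \forall p' \near p, df p' w = 'd f p' w.
  by near=> p'; rewrite dE//; near: p'; exact: open_nbhs_nbhs.
have dfp : 'd f p w = df p w by rewrite dE.
rewrite /prop_for /continuous_at dfp.
by apply: cvg_trans (dc p w Dp); apply: near_eq_cvg.
Unshelve. all: by end_near. Qed.

Lemma C1_on_eq D f g : open D -> (forall p, D p -> f p = g p) ->
  C1_on D f -> C1_on D g.
Proof.
move=> oD fg Cf.
have nfg p : D p -> {near p, f =1 g}.
  by move=> Dp; near=> y; apply: fg; near: y; exact: open_nbhs_nbhs.
apply: (C1_on_intro D g (fun p => 'd f p)) => // [p Dp|p Dp|p w Dp].
- by have [] := near_eq_diff _ _ _ _ (nfg p Dp) (Cf p Dp).1.
- by have [] := near_eq_diff _ _ _ _ (nfg p Dp) (Cf p Dp).1.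
- exact: (Cf p Dp).2.
Unshelve. all: by end_near. Qed.

Lemma C1_on_linear D (f : {linear U -> R}) : open D -> continuous f -> C1_on D f.
Proof.
move=> oD fc; apply: (C1_on_intro D f (fun _ => f)) => // [p _|p _|p w _].
- exact: linear_differentiable.
- exact: diff_lin.
- exact: cvg_cst.
Qed.

Lemma C1_on_cst D (c : R) : open D -> C1_on D (cst c).
Proof.
move=> oD; apply: (C1_on_intro D _ (fun _ _ => 0)) => // [p _|p w _].
- by rewrite diff_cst.
- exact: cvg_cst.
Qed.

Lemma C1_onD D f g : open D -> C1_on D f -> C1_on D g -> C1_on D (f + g).
Proof.
move=> oD Cf Cg.
apply: (C1_on_intro D _ (fun p w => 'd f p w + 'd g p w)) => // [p Dp|p Dp|p w Dp].
- exact: differentiableD (Cf p Dp).1 (Cg p Dp).1.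
- by rewrite diffD //; [exact: (Cf p Dp).1|exact: (Cg p Dp).1].
- exact: (cvgD ((Cf p Dp).2 w) ((Cg p Dp).2 w)).
Qed.

Lemma C1_onM D f g : open D -> C1_on D f -> C1_on D g -> C1_on D (f * g).
Proof.
move=> oD Cf Cg.
apply: (C1_on_intro D _ (fun p w => f p * 'd g p w + g p * 'd f p w))
   => // [p Dp|p Dp|p w Dp].
- exact: differentiableM (Cf p Dp).1 (Cg p Dp).1.
- by rewrite diffM //; [exact: (Cf p Dp).1|exact: (Cg p Dp).1].
- have cf := differentiable_continuous (Cf p Dp).1.
  have cg := differentiable_continuous (Cg p Dp).1.
  exact: (cvgD (cvgM cf ((Cg p Dp).2 w)) (cvgM cg ((Cf p Dp).2 w))).
Qed.

Lemma C1_onV D f : open D -> (forall p, D p -> f p != 0) -> C1_on D f ->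
  C1_on D (fun p => (f p)^-1).
Proof.
move=> oD f0 Cf.
apply: (C1_on_intro D _ (fun p w => - (f p) ^- 2 * 'd f p w))
   => // [p Dp|p Dp|p w Dp].
- exact: differentiableV (Cf p Dp).1 (f0 p Dp).
- by rewrite diffV //; [exact: (Cf p Dp).1|exact: f0].
- have cf := differentiable_continuous (Cf p Dp).1.
  apply: cvgM ((Cf p Dp).2 w); apply: cvgN; apply: cvgV.
    by rewrite expf_neq0 // f0.
  exact: (cvgM cf cf).
Qed.

Lemma C1_on_sum D (I : Type) (r : seq I) (P : pred I) (F : I -> U -> R) : open D ->
  (forall i, P i -> C1_on D (F i)) -> C1_on D (\sum_(i <- r | P i) F i).
Proof.
move=> oD CF.
apply: (big_ind (C1_on D)).
- exact: (C1_on_cst D 0 oD).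
- by move=> f g; exact: C1_onD.
- exact: CF.
Qed.

End C1.

Lemma C1_on_comp_linear (R : realType) (U W : normedModType R) (D : set W) (f : W -> R)
    (l : {linear U -> W}) : continuous l -> open D -> C1_on D f ->
  C1_on (l @^-1` D) (f \o l).
Proof.
move=> cl oD Cf.
have oE : open (l @^-1` D) by apply: open_comp => // x _; exact: cl.
have dl p : differentiable l p by exact: linear_differentiable.
apply: (C1_on_intro _ _ _ _ (fun p w => 'd f (l p) (l w))) => // [p Dp|p Dp|p w Dp].
- exact: differentiable_comp (dl p) (Cf _ Dp).1.
- by rewrite diff_comp ?diff_lin //; exact: (Cf _ Dp).1.
- by apply: (@continuous_comp _ _ _ l (fun q => 'd f q (l w)) p); [exact: cl|exact: (Cf _ Dp).2].
Qed.

(** * Linear forms and linear vector fields *)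

Section Linform.
Variables (R : realType) (n : nat).
Implicit Types nu x : 'cV[R]_n.

Fact linform_is_linear nu : linear (linform nu).
Proof.
move=> k x y; rewrite /linform scaler_sumr -big_split /=.
by apply: eq_bigr => i _; rewrite !mxE /= mulrDr mulrCA.
Qed.

HB.instance Definition _ nu :=
  GRing.isLinear.Build R 'cV[R]_n R _ (linform nu) (linform_is_linear nu).

Lemma linform_continuous nu : continuous (linform nu).
Proof.
apply: continuous_big => [|i _ x]; first exact: add_continuous.
exact: (cvgM (cvg_cst (nu i 0)) (coord_continuous (i := i) (j := 0) (x := x))).
Qed.

(** With [sys_fieldE] below, this is how the vector fields of the system act
on linear forms through the matrices [coef_mx]. *)
Lemma linform_mulmx (A : 'M[R]_n) nu x : linform (A *m nu) x = linform nu (A^T *m x).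
Proof.
rewrite /linform.
under eq_bigr do rewrite mxE mulr_suml.
rewrite exchange_big /=; apply: eq_bigr => j _.
rewrite mxE mulr_sumr; apply: eq_bigr => i _; rewrite mxE; ring.
Qed.

Lemma linform_delta nu i : linform nu (delta_mx i 0) = nu i 0.
Proof.
rewrite /linform (bigD1 i) //= mxE !eqxx mulr1 big1 ?addr0 // => j ji.
by rewrite mxE (negPf ji) mulr0.
Qed.

Lemma linform_sum (I : Type) (r : seq I) (P : pred I) (F : I -> 'cV[R]_n) x :
  linform (\sum_(i <- r | P i) F i) x = \sum_(i <- r | P i) linform (F i) x.
Proof.
rewrite /linform exchange_big /=; apply: eq_bigr => i _.
by rewrite summxE mulr_suml.
Qed.

Lemma linformZ k nu x : linform (k *: nu) x = k * linform nu x.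
Proof. by rewrite /linform mulr_sumr; apply: eq_bigr => i _; rewrite mxE mulrA. Qed.

Lemma vf_derivE (V : 'cV[R]_n -> 'cV[R]_n) (f : 'cV[R]_n -> R) x :
  differentiable f x -> vf_deriv V f x = 'd f x (V x).
Proof.
move=> df; rewrite /vf_deriv.
have VE : V x = \sum_i V x i 0 *: delta_mx i 0.
  by rewrite {1}[V x]matrix_sum_delta; apply: eq_bigr => i _; rewrite big_ord1.
rewrite {2}VE linear_sum; apply: eq_bigr => i _.
by rewrite deriveE // linearZ.
Qed.

Lemma vf_deriv_linform V nu x : vf_deriv V (linform nu) x = linform nu (V x).
Proof.
have c := @linform_continuous nu.
rewrite vf_derivE; last exact: linear_differentiable.
by rewrite diff_lin.
Qed.

Section System.
Variables (m : nat) (a : 'I_n -> 'I_m -> 'I_n -> R).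

Lemma sys_fieldE j x : sys_field a j x = (coef_mx a j)^T *m x.
Proof.
by apply/colP => i; rewrite !mxE; apply: eq_bigr => k _; rewrite !mxE.
Qed.

(** The Lie bracket of two linear vector fields is the linear vector field of
the commutator; its entries are read off at the basis vectors. *)
Lemma completely_solvable_comm j k : completely_solvable a ->
  coef_mx a j *m coef_mx a k = coef_mx a k *m coef_mx a j.
Proof.
move=> solv; apply/matrixP => r i.
have coordE l : (fun y => sys_field a l y i 0) = linform (col i (coef_mx a l)).
  apply/funext => y; rewrite sys_fieldE /linform mxE.
  by apply: eq_bigr => h _; rewrite !mxE.
have colE l h : linform (col i (coef_mx a l)) (sys_field a h (delta_mx r 0)) =
            (coef_mx a h *m coef_mx a l) r i.
  by rewrite sys_fieldE -linform_mulmx linform_delta colE mulmxA -colE mxE.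
have := solv j k (delta_mx r 0) => /(congr1 (fun M : 'cV_n => M i 0)).
rewrite !mxE !coordE !vf_deriv_linform !colE => /eqP.
by rewrite subr_eq0 => /eqP; rewrite !mxE.
Qed.
End System.
End Linform.

(** * Coordinates attached to a Jordan chain *)

Section ChainCoordinates.
Variables (R : realType) (n s : nat) (nu : nat -> 'cV[R]_n).
Variables (X : set 'cV[R]_n) (v : nat -> 'cV[R]_n -> R).
Hypothesis oX : open X.
Hypothesis X0 : forall x, X x -> linform (nu 0%N) x != 0.
Hypothesis vE : forall th, (th.+1 < s)%N -> forall x, X x ->
  linform (nu th.+1) x =
  \sum_(d < th.+1) 'C(th, d)%:R * (v d.+1 x * linform (nu (th - d)%N) x).

(** The equation of index th is linear in v_(th+1) with leading coefficient
nu^0 x, and expresses v_(th+1) by linear forms and the earlier v_d. *)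
Lemma chain_coordinate_C1 th : (th.+1 < s)%N -> C1_on X (v th.+1).
Proof.
elim/ltn_ind: th => th IH ths.
have Cnu u : C1_on X (linform u) by apply/C1_on_linear/linform_continuous.
(* The value of v_(th+1) obtained by solving the equation of index th. *)
pose G := (linform (nu th.+1) + \sum_(d < th)
  (cst (- 'C(th, d)%:R) * (v d.+1 * linform (nu (th - d)%N))))
  * (fun x => (linform (nu 0%N) x)^-1).
apply: (@C1_on_eq _ _ X G) => // [x Xx|].
  rewrite /G !fctE fct_sumE (vE _ ths) // big_ord_recr /= binn mul1r subnn.
  rewrite [X in X + _]addrC -addrA -big_split /= big1 ?addr0 ?mulfK ?X0 // => d _.
  by rewrite !fctE mulNr addrN.
apply: C1_onM => //; last exact: C1_onV (Cnu _).
apply: C1_onD => //; apply: C1_on_sum => // d _.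
apply: C1_onM => //; first exact: C1_on_cst.
apply: C1_onM => //; apply: IH => //.
by apply: ltn_trans ths; rewrite ltnS.
Qed.

(** The binomial action of A on the chain makes each v_d have constant
derivative along the field x |-> A^T x: at a fixed x,
[binomial_convolution_derivation] applies with D the derivative along the
field. *)
Lemma vf_deriv_chain_coordinate (A : 'M[R]_n) (V : 'cV[R]_n -> 'cV[R]_n)
    (c : nat -> R) :
  (forall x, V x = A^T *m x) ->
  (forall th, (th < s)%N ->
    A *m nu th = \sum_(k < th.+1) 'C(th, k)%:R *: (c k *: nu (th - k)%N)) ->
  forall th, (th.+1 < s)%N -> forall x, X x ->
  vf_deriv V (v th.+1) x = c th.+1.
Proof.
move=> VE Anu th ths x Xx.
have Dv d : (d.+1 < s)%N -> differentiable (v d.+1) x.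
  by move=> ds; have [] := chain_coordinate_C1 d ds x Xx.
have Dl u : differentiable (linform u) x.
  exact/linear_differentiable/linform_continuous.
have dl u : 'd (linform u) x = linform u :> (_ -> _).
  exact/diff_lin/linform_continuous.
have dlV u : 'd (linform u) x (V x) = linform (A *m u) x.
  by rewrite dl VE linform_mulmx.
rewrite vf_derivE; last exact: Dv.
apply: (@binomial_convolution_derivation _ s.-1 (fun k => linform (nu k) x)
  (fun k => linform (A *m nu k) x) (fun d => v d.+1 x)
  (fun d => 'd (v d.+1) x (V x)) c).
- exact: X0.
- move=> k ks; rewrite Anu ?linform_sum; last first.
    by case: s ths ks.
  by apply: eq_bigr => i _; rewrite !linformZ.
- by move=> k ks; apply: vE => //; case: s ks.
- move=> k; have [s0|s1] := posnP s; first by rewrite s0 in ths.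
  rewrite -ltnS prednK // => ks.
  (* Differentiate both sides of the equation of index k along V. *)
  pose G := \sum_(d < k.+1) (cst 'C(k, d)%:R * (v d.+1 * linform (nu (k - d)%N))).
  have dterm (d : 'I_k.+1) : differentiable (v d.+1) x.
    by apply: Dv; apply: leq_ltn_trans ks; rewrite ltn_ord.
  have nE : {near x, linform (nu k.+1) =1 G}.
    near=> y; rewrite /G fct_sumE vE //.
    by near: y; exact: open_nbhs_nbhs.
  have [_ dE] := near_eq_diff _ _ _ _ _ nE (Dl _).
  rewrite -dlV -dE -deriveE; last first.
    apply: differentiable_sum => d; apply: differentiableM => //.
    exact: differentiableM.
  rewrite derive_sum; last first.
    move=> d; apply: diff_derivable; apply: differentiableM => //.
    exact: differentiableM.
  apply: eq_bigr => d _; rewrite deriveM; last 2 first.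
  + exact: derivable_cst.
  + exact/diff_derivable/differentiableM.
  rewrite derive_cst scaler0 addr0 deriveM; [|exact: diff_derivable..].
  rewrite !deriveE // dlV.
  rewrite /= addrC; congr (_ * (_ + _)); exact: mulrC.
- by rewrite -ltnS prednK //; case: s ths.
Unshelve. all: by end_near. Qed.

End ChainCoordinates.

(** * First integrals *)

(** Along the system the function w grows at the constant rate mu_j in the
time t_j, which the subtracted linear function of time compensates. *)
Lemma autonomous_first_integral (R : realType) (m n : nat)
    (a : 'I_n -> 'I_m -> 'I_n -> R) (X : set 'cV[R]_n) (w : 'cV[R]_n -> R)
    (mu : 'I_m -> R) : open X -> C1_on X w ->
  (forall j x, X x -> vf_deriv (sys_field a j) w x = mu j) ->
  first_integral a (setT `*` X)
    (fun tx => w tx.2 - \sum_j mu j * tx.1 j 0).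
Proof.
move=> oX Cw wmu.
pose M : 'cV[R]_m := \col_j (- mu j).
have ME (t : 'cV[R]_m) : - (\sum_j mu j * t j 0) = linform M t.
  by rewrite /linform -sumrN; apply: eq_bigr => j _; rewrite mxE mulNr.
have c1 : continuous (fst : 'cV[R]_m * 'cV[R]_n -> _) by move=> p; exact: cvg_fst.
have c2 : continuous (snd : 'cV[R]_m * 'cV[R]_n -> _) by move=> p; exact: cvg_snd.
have oD : open (setT `*` X : set ('cV[R]_m * 'cV[R]_n)).
  by rewrite setTX; apply: open_comp => // x _; exact: c2.
split.
  have -> : (fun tx : 'cV[R]_m * 'cV[R]_n => w tx.2 - \sum_j mu j * tx.1 j 0) =
      (w \o snd) + (linform M \o fst).
    by apply/funext => tx; rewrite !fctE ME.
  apply: C1_onD => //.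
  - by rewrite setTX; apply: C1_on_comp_linear.
  - apply: C1_on_linear => // p; apply: continuous_comp; first exact: c1.
    exact: linform_continuous.
move=> j t x [_ /= Xx].
have -> : (fun t' : 'cV[R]_m => w x - \sum_j mu j * t' j 0) =
    cst (w x) + linform M.
  by apply/funext => t'; rewrite !fctE ME.
have Dl : differentiable (linform M) t.
  exact/linear_differentiable/linform_continuous.
rewrite deriveD; [|exact: derivable_cst|exact: diff_derivable].
rewrite derive_cst add0r deriveE // diff_lin; last exact: linform_continuous.
rewrite /= linform_delta mxE.
have dw : differentiable w x by have [] := Cw x Xx.
rewrite -(wmu j x Xx) addrC; apply/eqP; rewrite subr_eq0; apply/eqP.
rewrite /vf_deriv; apply: eq_bigr => i _; congr (_ * _).
rewrite (_ : (fun x' => _) = w + cst (- \sum_j mu j * t j 0)) //.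
rewrite deriveD; [|exact: diff_derivable|exact: derivable_cst].
by rewrite derive_cst addr0.
Qed.

Theorem theorem2p6 (R : realType) (m n : nat) (a : 'I_n -> 'I_m -> 'I_n -> R)
  (Hsolv : completely_solvable a)
  (zeta : 'I_m)
  (Hzeta : forall j : 'I_m,
     (size (real_elementary_divisors (coef_mx a zeta)) <=
      size (real_elementary_divisors (coef_mx a j)))%N)
  (lambda : 'I_m -> R) (s : nat) (Hs : (2 <= s)%N)
  (nu : nat -> 'cV[R]_n)
  (Hnu0 : forall j : 'I_m, is_eigenvector (coef_mx a j) (lambda j) (nu 0%N))
  (Hdiv : ('X - ((lambda zeta)%:C%C)%:P) ^+ s
            \in real_elementary_divisors (coef_mx a zeta))
  (Hnu : forall theta : nat, (1 <= theta < s)%N ->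
     is_gen_eigenvector (coef_mx a zeta) (lambda zeta) nu theta)
  (X : set 'cV[R]_n) (HX : domain X)
  (HX0 : X `<=` [set x | linform (nu 0%N) x != 0])
  (v : nat -> 'cV[R]_n -> R)
  (Hv : forall theta : nat, (1 <= theta < s)%N -> forall x, X x ->
     linform (nu theta) x =
     \sum_(1 <= delta < theta.+1)
        'C(theta.-1, delta.-1)%:R * v delta x * linform (nu (theta - delta)%N) x)
  (q : nat) (Hq : (1 <= q < s)%N)
  (Hconst : (1 < geometric_multiplicity (coef_mx a zeta) (lambda zeta))%N ->
     forall j : 'I_m, j != zeta ->
     exists c : R, forall x, X x -> vf_deriv (sys_field a j) (v q) x = c) :
  exists mu : 'I_m -> R,
    (forall (j : 'I_m) x, X x -> vf_deriv (sys_field a j) (v q) x = mu j) /\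
    first_integral a (setT `*` X)
      (fun tx => v q tx.2 - \sum_j mu j * tx.1 j 0).
Proof.
have oX : open X by case: HX.
have vE th : (th.+1 < s)%N -> forall x, X x -> linform (nu th.+1) x =
    \sum_(d < th.+1) 'C(th, d)%:R * (v d.+1 x * linform (nu (th - d)%N) x).
  move=> ths x Xx; rewrite Hv // big_add1 big_mkord.
  by apply: eq_bigr => d _; rewrite subSS mulrA.
case: q Hq Hconst => [|q] // qs Hconst.
suff: forall j, exists c : R, forall x, X x ->
    vf_deriv (sys_field a j) (v q.+1) x = c.
  move=> /choice[mu muE]; exists mu; split => //.
  by apply: autonomous_first_integral => //; apply: (@chain_coordinate_C1 _ _ s nu).
have constP j (c : nat -> R) : (forall th, (th < s)%N -> coef_mx a j *m nu th =
      \sum_(k < th.+1) 'C(th, k)%:R *: (c k *: nu (th - k)%N)) ->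
    exists c : R, forall x, X x -> vf_deriv (sys_field a j) (v q.+1) x = c.
  move=> chainE; exists (c q.+1) => x Xx.
  exact: (@vf_deriv_chain_coordinate _ _ s nu X v _ _ _ (coef_mx a j) _ c
            (fun y => sys_fieldE _ _ _ _ _ _)).
move=> j; have [->|jz] := eqVneq j zeta.
  (* A_zeta = lambda + N with N nu^th = th nu^(th-1), and th = C(th, 1). *)
  apply: (constP _ (fun k => nth 0 [:: lambda zeta; 1] k)) => -[|th] ths.
    by rewrite big_ord_recl big_ord0 addr0 bin0 scale1r subn0 (Hnu0 zeta).2.
  rewrite !big_ord_recl big1 => [|k _]; last first.
    by rewrite /= nth_nil scale0r scaler0.
  rewrite addr0 /= bin0 /bump /= bin1 !scale1r subn0 subSS subn0.
  have [_] := Hnu th.+1 ths; rewrite mulmxBl mul_scalar_mx => /eqP.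
  by rewrite subr_eq addrC => /eqP.
have [gm|gm] := leqP (geometric_multiplicity (coef_mx a zeta) (lambda zeta)) 1.
  have [c cE] := commuting_chain _ _ _ _ _ _ s nu
    (completely_solvable_comm _ _ _ _ zeta j Hsolv) gm (Hnu0 zeta) (Hnu0 j) Hnu.
  exact: constP cE.
exact: Hconst.
Qed.
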